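(* Let $\mathbf s_0,\ldots,\mathbf s_4$ be an admissible configuration of spherical points, i.e. $\mathbf s_0,\mathbf s_4\in\mathbb S^2$ with $\mathbf s_0\neq\mathbf s_4$, $\mathbf s_2\in\mathcal C(\mathbf s_0,\mathbf s_4)$, $\mathbf s_1\in\mathcal C(\mathbf s_0,\mathbf s_2)$, $\mathbf s_3\in\mathcal C(\mathbf s_4,\mathbf s_2)$, and $\mathbf s_0,\ldots,\mathbf s_4$ are the spherical control points of some RRMF5-I curve. Then for any choice of nonzero lengths $|\mathbf h_0|$ and $|\mathbf h_4|$ there exists precisely one set of control points $\mathbf h_0,\ldots,\mathbf h_4$, with $\mathbf h_i/|\mathbf h_i|=\mathbf s_i$ for $i=0,\dots,4$ and with $\mathbf h_0,\mathbf h_4$ of the prescribed lengths, representing the hodograph of an RRMF5-I curve. Moreover, for various choices of $|\mathbf h_0|$ and $|\mathbf h_4|$, the corresponding tangent indicatrices are related via a linear rational reparameterization of $[0,1]$, i.e. one of the form $\xi(\tilde t)=\dfrac{\lambda\tilde t}{(\lambda-1)\tilde t+1}$ with $\lambda>0$. Consequently, the image of the tangent indicatrix is fully characterized by the points $\mathbf s_i$, $i=0,\ldots,4$.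
   Context: Let $\mathbb H$ be the quaternions, with pure vector quaternions identified with $\mathbb R^3$; $\mathcal A^*$ denotes conjugation and $\mathrm{vect}(\mathcal A)$ the vector part. Fix a unit pure vector $\mathbf i$. Let $B_i^n(t)=\binom ni t^i(1-t)^{n-i}$. An RRMF5-I curve (quintic curve of class I with rational rotation-minimizing frame) is a polynomial curve $\mathbf r:[0,1]\to\mathbb R^3$ whose hodograph is $\mathbf h(t)=\mathbf r'(t)=\mathcal A(t)\,\mathbf i\,\mathcal A^*(t)$, where $\mathcal A(t)=\mathcal A_0B_0^2(t)+\mathcal A_1B_1^2(t)+\mathcal A_2B_2^2(t)$ is a quaternion polynomial (the pre-image) with $\mathcal A_0,\mathcal A_1,\mathcal A_2\in\mathbb H$ satisfying $$\mathcal A_1\,\mathbf i\,\mathcal A_1^*=\mathrm{vect}(\mathcal A_2\,\mathbf i\,\mathcal A_0^* ).$$ The hodograph control points $\mathbf h_0,\ldots,\mathbf h_4\in\mathbb R^3$ are the Bernstein coefficients in $\mathbf h(t)=\sum_{i=0}^4\mathbf h_iB_i^4(t)$. When $\mathbf h_i\neq\mathbf 0$ for all $i=0,\ldots,4$, the spherical control points are $\mathbf s_i=\mathbf h_i/|\mathbf h_i|\in\mathbb S^2$. For distinct $\mathbf v,\mathbf w\in\mathbb S^2$, $\mathcal C(\mathbf v,\mathbf w)=\{\mathbf x\in\mathbb S^2:\mathbf x\cdot\mathbf v=\mathbf x\cdot\mathbf w\}$ is the great circle of points equidistant from $\mathbf v$ and $\mathbf w$. The tangent indicatrix of the curve is the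 curve on $\mathbb S^2$ given by $\mathbf t(t)=\dfrac{\mathcal A(t)\,\mathbf i\,\mathcal A^*(t)}{\mathcal A(t)\mathcal A^*(t)}$, $t\in[0,1]$; if $\mathcal A$ has real roots in $[0,1]$, one writes $\mathcal A=\chi\mathcal Q$ with $\chi$ a real polynomial and $\mathcal Q$ a quaternion polynomial never vanishing on $[0,1]$, and uses $\mathcal Q$ in place of $\mathcal A$. *)

(* Defs.v *)
From HB Require Import structures.
From mathcomp Require Export all_boot all_order all_algebra.
From mathcomp Require Export boolp classical_sets set_interval reals.
From mathcomp Require Import ring lra.
Set Implicit Arguments.
Unset Strict Implicit.
Unset Printing Implicit Defensive.
Import Order.TTheory GRing.Theory Num.Theory.
Local Open Scope ring_scope.
Local Open Scope classical_set_scope.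

(* The algebra is built over any commutative ring T, so that quat R is H and
   quat {poly R} is the algebra of quaternion polynomials H[t], whose variable
   is central. *)
Record quat (T : Type) : Type := Quat { q_re : T; q_i : T; q_j : T; q_k : T }.

Section QuatChoice.
Variable T : Type.

Definition quat_to_tuple (q : quat T) : T * T * T * T :=
  (q_re q, q_i q, q_j q, q_k q).

Definition quat_of_tuple (x : T * T * T * T) : quat T :=
  Quat x.1.1.1 x.1.1.2 x.1.2 x.2.

Lemma quat_to_tupleK : cancel quat_to_tuple quat_of_tuple.
Proof. by case. Qed.

End QuatChoice.

HB.instance Definition _ (T : eqType) :=
  Equality.copy (quat T) (can_type (@quat_to_tupleK T)).
HB.instance Definition _ (T : choiceType) :=
  Choice.copy (quat T) (can_type (@quat_to_tupleK T)).

Section QuatRing.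
Variable T : comNzRingType.
Implicit Types p q r : quat T.

Definition quat_zero : quat T := Quat 0 0 0 0.
Definition quat_one : quat T := Quat 1 0 0 0.
Definition quat_opp q := Quat (- q_re q) (- q_i q) (- q_j q) (- q_k q).
Definition quat_add p q :=
  Quat (q_re p + q_re q) (q_i p + q_i q) (q_j p + q_j q) (q_k p + q_k q).
Definition quat_mul p q :=
  Quat (q_re p * q_re q - q_i p * q_i q - q_j p * q_j q - q_k p * q_k q)
       (q_re p * q_i q + q_i p * q_re q + q_j p * q_k q - q_k p * q_j q)
       (q_re p * q_j q - q_i p * q_k q + q_j p * q_re q + q_k p * q_i q)
       (q_re p * q_k q + q_i p * q_j q - q_j p * q_i q + q_k p * q_re q).
Definition quat_scale (a : T) q :=
  Quat (a * q_re q) (a * q_i q) (a * q_j q) (a * q_k q).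

Let addA : associative quat_add.
Proof. by case=> ? ? ? ? [? ? ? ?] [? ? ? ?]; rewrite /quat_add /= !addrA. Qed.
Let addC : commutative quat_add.
Proof. by case=> ? ? ? ? [? ? ? ?]; congr Quat; exact: addrC. Qed.
Let add0 : left_id quat_zero quat_add.
Proof. by case=> ? ? ? ?; rewrite /quat_add /= !add0r. Qed.
Let addN : left_inverse quat_zero quat_opp quat_add.
Proof. by case=> ? ? ? ?; rewrite /quat_add /= !addNr. Qed.

HB.instance Definition _ := GRing.isZmodule.Build (quat T) addA addC add0 addN.

Let mulA : associative quat_mul.
Proof. by case=> ? ? ? ? [? ? ? ?] [? ? ? ?]; congr Quat => /=; ring. Qed.
Let mul1 : left_id quat_one quat_mul.
Proof. by case=> ? ? ? ?; congr Quat => /=; ring. Qed.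
Let mulq1 : right_id quat_one quat_mul.
Proof. by case=> ? ? ? ?; congr Quat => /=; ring. Qed.
Let mulDl : left_distributive quat_mul quat_add.
Proof. by case=> ? ? ? ? [? ? ? ?] [? ? ? ?]; congr Quat => /=; ring. Qed.
Let mulDr : right_distributive quat_mul quat_add.
Proof. by case=> ? ? ? ? [? ? ? ?] [? ? ? ?]; congr Quat => /=; ring. Qed.
Let one_neq0 : quat_one != quat_zero.
Proof. by apply/eqP => -[] /eqP; rewrite oner_eq0. Qed.

HB.instance Definition _ := GRing.Zmodule_isNzRing.Build (quat T)
  mulA mul1 mulq1 mulDl mulDr one_neq0.

Let scaleA a b q : quat_scale a (quat_scale b q) = quat_scale (a * b) q.
Proof. by case: q => ? ? ? ?; congr Quat => /=; rewrite mulrA. Qed.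
Let scale1 : left_id 1 quat_scale.
Proof. by case=> ? ? ? ?; congr Quat => /=; rewrite mul1r. Qed.
Let scaleDr : right_distributive quat_scale +%R.
Proof. by move=> a [? ? ? ?] [? ? ? ?]; congr Quat => /=; rewrite mulrDr. Qed.
Let scaleDl q : {morph quat_scale^~ q : a b / a + b}.
Proof. by case: q => ? ? ? ? a b; congr Quat => /=; rewrite mulrDl. Qed.

HB.instance Definition _ := GRing.Zmodule_isLmodule.Build T (quat T)
  scaleA scale1 scaleDr scaleDl.

Let scaleAl (a : T) p q : a *: (p * q) = a *: p * q.
Proof. by case: p q => ? ? ? ? [? ? ? ?]; congr Quat => /=; ring. Qed.

HB.instance Definition _ := GRing.Lmodule_isLalgebra.Build T (quat T) scaleAl.

Let scaleAr (a : T) p q : a *: (p * q) = p * (a *: q).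
Proof. by case: p q => ? ? ? ? [? ? ? ?]; congr Quat => /=; ring. Qed.

HB.instance Definition _ := GRing.Lalgebra_isAlgebra.Build T (quat T) scaleAr.

Definition conjq q : quat T := Quat (q_re q) (- q_i q) (- q_j q) (- q_k q).

(* The identification of 'rV[T]_3 with the pure vector quaternions. *)
Definition pure (v : 'rV[T]_3) : quat T := Quat 0 (v 0 0) (v 0 1) (v 0 2).
Definition vect q : 'rV[T]_3 := \row_(k < 3) nth 0 [:: q_i q; q_j q; q_k q] k.

Lemma pureK : cancel pure vect.
Proof.
move=> v; apply/rowP => -[[|[|[|//]]] i]; rewrite mxE /=; congr (v _ _);
  exact: val_inj.
Qed.

Lemma vectK q : q_re q = 0 -> pure (vect q) = q.
Proof. by case: q => a b c d /= ->; rewrite /pure !mxE. Qed.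

Lemma mulq_conj q :
  q * conjq q = (q_re q ^+ 2 + q_i q ^+ 2 + q_j q ^+ 2 + q_k q ^+ 2)%:A.
Proof. by case: q => ? ? ? ?; congr Quat => /=; ring. Qed.

Lemma re_mulq_conj q :
  q_re (q * conjq q) = q_re q ^+ 2 + q_i q ^+ 2 + q_j q ^+ 2 + q_k q ^+ 2.
Proof. by case: q => ? ? ? ? /=; ring. Qed.

Lemma conjq_scale (a : T) q : conjq (a *: q) = a *: conjq q.
Proof. by case: q => ? ? ? ?; congr Quat => /=; ring. Qed.

Lemma vect_scale (a : T) q : vect (a *: q) = a *: vect q.
Proof. by apply/rowP => -[[|[|[|//]]] i]; rewrite !mxE /=. Qed.

End QuatRing.

Definition qmap (T U : Type) (f : T -> U) (q : quat T) : quat U :=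
  Quat (f (q_re q)) (f (q_i q)) (f (q_j q)) (f (q_k q)).

Section Curves.
Variable R : realType.
Implicit Types (u v w : 'rV[R]_3) (A Q : quat {poly R}) (r : 'rV[{poly R}]_3).

(* The norm `|v| of MathComp-Analysis on 'rV[R]_3 is the sup norm, hence the
   Euclidean structure below. *)
Definition dot v w : R := \sum_(k < 3) v 0 k * w 0 k.
Definition enorm v : R := Num.sqrt (dot v v).
Definition normalize v : 'rV[R]_3 := (enorm v)^-1 *: v.
Definition sphere : set 'rV[R]_3 := [set x | enorm x = 1].

Definition equidistant_circle v w : set 'rV[R]_3 :=
  [set x | sphere x /\ dot x v = dot x w].

Definition bernstein (n i : nat) : {poly R} :=
  'C(n, i)%:R *: ('X^i * (1 - 'X) ^+ (n - i)).

Definition qhorner Q (t : R) : quat R := qmap (horner^~ t) Q.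

Definition quadratic_preimage (A0 A1 A2 : quat R) : quat {poly R} :=
  bernstein 2 0 *: qmap polyC A0 + bernstein 2 1 *: qmap polyC A1
  + bernstein 2 2 *: qmap polyC A2.

Definition rrmf5I_condition u (A0 A1 A2 : quat R) : Prop :=
  A1 * pure u * conjq A1 = pure (vect (A2 * pure u * conjq A0)).

(* A polynomial curve is given by its three coordinate polynomials; identities
   between polynomials are the same as identities on [0, 1]. *)
Definition hodograph r : 'rV[{poly R}]_3 := map_mx (@deriv R) r.

(* u is the fixed unit vector written as a bold i. *)
Definition rrmf5I_preimage u A r : Prop :=
  exists A0 A1 A2 : quat R,
    [/\ A = quadratic_preimage A0 A1 A2,
        rrmf5I_condition u A0 A1 A2
      & pure (hodograph r) = A * pure (map_mx polyC u) * conjq A].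

Definition rrmf5I_curve u r : Prop := exists A, rrmf5I_preimage u A r.

Definition hodograph_control_points r (h : 'I_5 -> 'rV[R]_3) : Prop :=
  hodograph r = \sum_(i < 5) bernstein 4 i *: map_mx polyC (h i).

Definition spherical_control_points r (s : 'I_5 -> 'rV[R]_3) : Prop :=
  exists2 h, hodograph_control_points r h &
    forall i, h i != 0 /\ s i = normalize (h i).

Definition admissible u (s : 'I_5 -> 'rV[R]_3) : Prop :=
  [/\ [/\ sphere (s 0), sphere (s 4) & s 0 <> s 4],
      equidistant_circle (s 0) (s 4) (s 2),
      equidistant_circle (s 0) (s 2) (s 1),
      equidistant_circle (s 4) (s 2) (s 3)
    & exists2 r, rrmf5I_curve u r & spherical_control_points r s].

Definition nonvanishing01 Q : Prop :=
  forall t : R, 0 <= t <= 1 -> qhorner Q t != 0.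

(* A = chi Q with chi a real polynomial and Q nowhere zero on [0, 1]; when A
   itself has no root there, A is one such Q. *)
Definition root_free_part A Q : Prop :=
  (exists chi : {poly R}, A = chi *: Q) /\ nonvanishing01 Q.

Definition tangent_direction u Q (t : R) : 'rV[R]_3 :=
  (q_re (qhorner Q t * conjq (qhorner Q t)))^-1 *:
    vect (qhorner Q t * pure u * conjq (qhorner Q t)).

(* Lemmas root_free_part_exists and tangent_indicatrixE show that the choice
   of Q is possible as soon as A != 0, and that it does not matter. *)
Definition tangent_indicatrix u A : R -> 'rV[R]_3 :=
  tangent_direction u (xget 0 [set Q | root_free_part A Q]).

Definition tangent_image u A : set 'rV[R]_3 :=
  tangent_indicatrix u A @` `[0, 1].

Definition linear_rational (lambda t : R) : R :=
  (lambda * t) / ((lambda - 1) * t + 1).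

Lemma re_mulq_conj_eq0 (q : quat R) : (q_re (q * conjq q) == 0) = (q == 0).
Proof.
rewrite re_mulq_conj; case: q => a b c d /=.
rewrite !paddr_eq0 ?addr_ge0 ?sqr_ge0 // !sqrf_eq0.
apply/idP/eqP => [/andP[/andP[/andP[]]]|]; last by case=> -> -> -> ->; rewrite !eqxx.
by move=> /eqP-> /eqP-> /eqP-> /eqP->.
Qed.

Lemma root_free_part_exists A : A != 0 -> exists Q, root_free_part A Q.
Proof.
case: A => a b c d A0.
pose g := gcdp (gcdp a b) (gcdp c d).
have ga : g %| a by apply: dvdp_trans (dvdp_gcdl _ _) (dvdp_gcdl _ _).
have gb : g %| b by apply: dvdp_trans (dvdp_gcdl _ _) (dvdp_gcdr _ _).
have gc : g %| c by apply: dvdp_trans (dvdp_gcdr _ _) (dvdp_gcdl _ _).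
have gd : g %| d by apply: dvdp_trans (dvdp_gcdr _ _) (dvdp_gcdr _ _).
have g0 : g != 0.
  apply: contra_neq A0 => g0; move: ga gb gc gd.
  by rewrite g0 !dvd0p => /eqP-> /eqP-> /eqP-> /eqP->.
exists (Quat (a %/ g) (b %/ g) (c %/ g) (d %/ g)); split.
  by exists g; congr Quat; rewrite /= mulrC divpK.
move=> t _; apply/negP => /eqP [ta tb tc td].
have dvd p : g %| p -> (p %/ g).[t] = 0 -> ('X - t%:P) * g %| p.
  move=> gp pt; rewrite -[X in _ %| X](divpK gp) dvdp_mul2r //.
  by rewrite dvdp_XsubCl /root pt.
have : ('X - t%:P) * g %| g by rewrite !dvdp_gcd !dvd.
rewrite -{2}[g]mul1r dvdp_mul2r // dvdp1 size_XsubC.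
by [].
Qed.

Lemma root_free_part_proportional A Q Q' t : A != 0 ->
    root_free_part A Q -> root_free_part A Q' -> 0 <= t <= 1 ->
  exists2 c : R, c != 0 & qhorner Q' t = c *: qhorner Q t.
Proof.
move=> A0 [[chi eA] nQ] [[chi' eA'] nQ'] t01.
have chi0 : chi != 0 by apply: contra_neq A0 => c0; rewrite eA c0 scale0r.
have chi'0 : chi' != 0 by apply: contra_neq A0 => c0; rewrite eA' c0 scale0r.
have crossE (x y x' y' : {poly R}) :
    chi * x = chi' * x' -> chi * y = chi' * y' -> x.[t] * y'.[t] = y.[t] * x'.[t].
  move=> ex ey; rewrite -!hornerM; congr (_.[t]).
  apply: (mulfI (mulf_neq0 chi0 chi'0)).
  have -> : chi * chi' * (x * y') = (chi * x) * (chi' * y') by ring.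
  by rewrite ex -ey; ring.
move: (nQ t t01) (nQ' t t01); rewrite eA' in eA.
case: Q Q' eA {eA' nQ nQ'} => [a b c d] [a' b' c' d'] [ea eb ec ed].
have := crossE _ _ _ _ (esym ea) (esym eb).
have := crossE _ _ _ _ (esym ea) (esym ec).
have := crossE _ _ _ _ (esym ea) (esym ed).
have := crossE _ _ _ _ (esym eb) (esym ec).
have := crossE _ _ _ _ (esym eb) (esym ed).
have := crossE _ _ _ _ (esym ec) (esym ed).
rewrite /qhorner /qmap /=.
move: {a b c d a' b' c' d' ea eb ec ed}(a.[t]) (b.[t]) (c.[t]) (d.[t])
  (a'.[t]) (b'.[t]) (c'.[t]) (d'.[t]) => a b c d a' b' c' d'.
move=> ecd ebd ebc ead eac eab q0 q'0.
have n0 : a ^+ 2 + b ^+ 2 + c ^+ 2 + d ^+ 2 != 0.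
  by rewrite -re_mulq_conj_eq0 re_mulq_conj in q0.
pose n := a ^+ 2 + b ^+ 2 + c ^+ 2 + d ^+ 2.
pose m := a * a' + b * b' + c * c' + d * d'.
pose k := m / n.
have divE x x' : x' * n = m * x -> x' = k * x.
  by move=> e; apply: (mulIf n0); rewrite -/n e /k mulrAC divfK.
have E : Quat a' b' c' d' = k *: Quat a b c d.
  congr Quat; apply: divE; rewrite /m /n /=.
  - rewrite [LHS](_ : _ =
      a * a' * a + b * (b * a') + c * (c * a') + d * (d * a')); last by ring.
    by rewrite -eab -eac -ead; ring.
  - rewrite [LHS](_ : _ =
      a * (a * b') + b * b' * b + c * (c * b') + d * (d * b')); last by ring.
    by rewrite eab -ebc -ebd; ring.
  - rewrite [LHS](_ : _ =
      a * (a * c') + b * (b * c') + c * c' * c + d * (d * c')); last by ring.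
    by rewrite eac ebc -ecd; ring.
  - rewrite [LHS](_ : _ =
      a * (a * d') + b * (b * d') + c * (c * d') + d * d' * d); last by ring.
    by rewrite ead ebd ecd; ring.
by exists k => //; apply: contra_neq q'0 => k0; rewrite E k0 scale0r.
Qed.

Lemma tangent_indicatrixE u A Q t : A != 0 -> root_free_part A Q ->
  0 <= t <= 1 -> tangent_indicatrix u A t = tangent_direction u Q t.
Proof.
move=> A0 QA t01; rewrite /tangent_indicatrix.
case: xgetP => [Q' _ Q'A|/(_ Q)//].
have [c c0 cE] := root_free_part_proportional A0 QA Q'A t01.
rewrite /tangent_direction cE conjq_scale -!scalerAl -!scalerAr !scalerA.
rewrite vect_scale scalerA; congr (_ *: _).
rewrite /= invfM mulrAC mulVf ?mul1r // mulf_neq0 //.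
Qed.

End Curves.

(* Main.v *)
Require Import Defs.
From mathcomp Require Import ring lra.
Set Implicit Arguments.
Unset Strict Implicit.
Unset Printing Implicit Defensive.
Import Order.TTheory GRing.Theory Num.Theory.
Local Open Scope ring_scope.
Local Open Scope classical_set_scope.

(** Write [polar u A B] for the vector part of [A u B*]. It is symmetric and
    bilinear, and the five control points of the hodograph of an RRMF5-I curve
    with pre-image coefficients [A0], [A1], [A2] are
      [h0 = polar A0 A0], [h1 = polar A0 A1], [h2 = polar A1 A1 = polar A0 A2],
      [h3 = polar A1 A2], [h4 = polar A2 A2],
    the double expression of [h2] being the class I condition. Conversely every
    triple satisfying it comes from a curve.

    Existence: scaling [A0], [A1], [A2] by [a^2], [a b], [b^2] respects the
    condition and multiplies [h i] by [a^(4-i) b^i], so directions are kept while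
    [|h0|] and [|h4|] are adjusted at will ([rescaled_preimage_points]).

    Rigidity: the vector [polar A B] lies on an ellipse determined by [polar A A]
    and [polar B B], as long as these have distinct directions
    ([enorm_polar]); a ray meets this ellipse once. Explicitly, the square of
    the length of [polar A B] is [|polar A A| |polar B B|] times a factor that
    depends on the directions only. Applied to [h2] between [h0] and [h4], to [h1]
    between [h0] and [h2], and to [h3] between [h2] and [h4], this shows that two
    curves with the same spherical control points have control points related
    by [h' i = a^(4-i) b^i h i] for some positive [a], [b]
    ([preimage_points_rigid]). Equal end lengths give [a = b = 1], which is
    uniqueness.

    Indicatrices: weighting Bernstein coefficients by [a^(4-i) b^i] is the same,
    up to a positive factor, as substituting the linear rational function with
    [lambda = b / a] ([bernstein_reparam]). Since the pre-image has no root on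
    [0, 1] ([quadratic_preimage_neq0]), the tangent indicatrix is the direction
    of the hodograph, so it undergoes the same substitution. *)

Lemma ord5P (P : 'I_5 -> Prop) : P 0 -> P 1 -> P 2 -> P 3 -> P 4 -> forall i, P i.
Proof.
move=> P0 P1 P2 P3 P4 [[|[|[|[|[|//]]]]] lti];
  [move: P0|move: P1|move: P2|move: P3|move: P4];
  by congr P; apply: val_inj.
Qed.

Lemma row3P (T : Type) (v w : 'rV[T]_3) :
  v 0 0 = w 0 0 -> v 0 1 = w 0 1 -> v 0 2 = w 0 2 -> v = w.
Proof.
move=> e0 e1 e2; apply/rowP => -[[|[|[|//]]] lti];
  [move: e0|move: e1|move: e2]; by congr (v _ _ = w _ _); apply: val_inj.
Qed.

(** * The polarized hodograph *)

Section Polar.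
Variable T : comNzRingType.
Implicit Types (u v : 'rV[T]_3) (A B C : quat T).

(** The vector-valued symmetric bilinear form whose quadratic form
    [A u A*] is the hodograph map; every control point of the hodograph is one
    of its values. *)
Definition polar u A B : 'rV[T]_3 := vect (A * pure u * conjq B).

Lemma polarC u A B : polar u A B = polar u B A.
Proof.
case: A B => a b c d [a' b' c' d'].
by apply: row3P; rewrite !mxE /=; ring.
Qed.

Lemma polarDl u A B C : polar u (A + B) C = polar u A C + polar u B C.
Proof. by rewrite /polar !mulrDl; apply: row3P; rewrite !mxE /=. Qed.

Lemma polarZl u (a : T) A B : polar u (a *: A) B = a *: polar u A B.
Proof. by rewrite /polar -!scalerAl vect_scale. Qed.

Lemma polarDr u A B C : polar u A (B + C) = polar u A B + polar u A C.
Proof. by rewrite polarC polarDl !(polarC u _ A). Qed.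

Lemma polarZr u (a : T) A B : polar u A (a *: B) = a *: polar u A B.
Proof. by rewrite polarC polarZl (polarC u A). Qed.

Lemma pure_polar u A : pure (polar u A A) = A * pure u * conjq A.
Proof. by rewrite vectK //; case: A => a b c d /=; ring. Qed.

End Polar.

Section PolarIdentities.
Variable R : realType.
Implicit Types (u v w x : 'rV[R]_3) (A B : quat R).

(** The scalar triple product, i.e. the determinant of the three vectors. *)
Definition triple v w x : R :=
  v 0 0 * (w 0 1 * x 0 2 - w 0 2 * x 0 1) +
  v 0 1 * (w 0 2 * x 0 0 - w 0 0 * x 0 2) +
  v 0 2 * (w 0 0 * x 0 1 - w 0 1 * x 0 0).

Lemma dotE v w : dot v w = v 0 0 * w 0 0 + v 0 1 * w 0 1 + v 0 2 * w 0 2.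
Proof.
rewrite /dot !big_ord_recr big_ord0 /= add0r.
by congr (v _ _ * w _ _ + v _ _ * w _ _ + v _ _ * w _ _); apply: val_inj.
Qed.

Definition sqnorm A : R := q_re (A * conjq A).

Lemma dot_polar_diag u A : dot u u = 1 ->
  dot (polar u A A) (polar u A A) = sqnorm A ^+ 2.
Proof.
move=> u1; rewrite -[RHS]mulr1 -u1 !dotE !mxE /sqnorm;
  case: A => a b c d /=; ring.
Qed.

(** Multiplicativity of the quaternion norm: [A u B*] has norm [|A||B|], and
    its squared norm is shared between its vector part and its real part. *)
Lemma dot_polar u A B : dot u u = 1 ->
  dot (polar u A B) (polar u A B) + q_re (A * pure u * conjq B) ^+ 2
  = sqnorm A * sqnorm B.
Proof.
move=> u1; rewrite -[RHS]mulr1 -u1 !dotE !mxE /sqnorm;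
  case: A B => a b c d [a' b' c' d'] /=; ring.
Qed.

(** Unless [polar u A A] and [polar u B B] have the same direction, this gives the
    real part of [A u B*] in terms of vectors only. With [w = A u B*] and [b = B u B*] one has
    [w b w* = |B|^4 A u A*], so the claim amounts to an identity between the
    real part of [w], its vector part and [b]; it is checked in coordinates. *)
Lemma triple_polar u A B : dot u u = 1 ->
  triple (polar u A B) (polar u A A) (polar u B B)
  = - q_re (A * pure u * conjq B) *
    (sqnorm A * sqnorm B - dot (polar u A A) (polar u B B)).
Proof.
move=> u1; rewrite -[sqnorm A * _]mulr1 -u1 !dotE /triple !mxE /sqnorm;
  case: A B => a b c d [a' b' c' d'] /=; ring.
Qed.

End PolarIdentities.

(** * Euclidean geometry of the polarized hodograph *)

Section Euclid.
Variable R : realType.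
Implicit Types (u v w x : 'rV[R]_3) (A B : quat R).

Lemma dotC v w : dot v w = dot w v.
Proof. by rewrite !dotE; ring. Qed.

Lemma dotZl c v w : dot (c *: v) w = c * dot v w.
Proof. by rewrite !dotE !mxE; ring. Qed.

Lemma dotBl v w x : dot (v - w) x = dot v x - dot w x.
Proof. by rewrite !dotE !mxE; ring. Qed.

Lemma dot_ge0 v : 0 <= dot v v.
Proof. by rewrite dotE -!expr2 !addr_ge0 ?sqr_ge0. Qed.

Lemma dot_eq0 v : dot v v = 0 -> v = 0.
Proof.
rewrite dotE -!expr2 => /eqP.
rewrite !paddr_eq0 ?addr_ge0 ?sqr_ge0 // !sqrf_eq0.
move=> /andP[/andP[/eqP e0 /eqP e1] /eqP e2].
by apply: row3P; rewrite mxE.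
Qed.

Lemma enorm_ge0 v : 0 <= enorm v. Proof. exact: sqrtr_ge0. Qed.

Lemma sqr_enorm v : enorm v ^+ 2 = dot v v.
Proof. by rewrite sqr_sqrtr ?dot_ge0. Qed.

Lemma enormZ c v : 0 <= c -> enorm (c *: v) = c * enorm v.
Proof.
move=> c0; rewrite /enorm dotZl dotC dotZl mulrA -expr2.
by rewrite sqrtrM ?sqr_ge0 // sqrtr_sqr ger0_norm.
Qed.

Lemma enorm_gt0 v : v != 0 -> 0 < enorm v.
Proof.
move=> v0; rewrite lt_neqAle enorm_ge0 andbT eq_sym.
by apply: contra_neq v0 => e; apply: dot_eq0; rewrite -sqr_enorm e expr0n.
Qed.

Lemma sphere_dot v : sphere v -> dot v v = 1.
Proof. by rewrite -sqr_enorm => ->; rewrite expr1n. Qed.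

Lemma sphere_normalize v : v != 0 -> sphere (normalize v).
Proof.
move=> /enorm_gt0 v0; rewrite /sphere/= /normalize enormZ ?invr_ge0 ?enorm_ge0 //.
by rewrite mulVf // gt_eqF.
Qed.

Lemma enorm_normalize v : v != 0 -> enorm v *: normalize v = v.
Proof. by move=> /enorm_gt0 v0; rewrite scalerA mulfV ?scale1r // gt_eqF. Qed.

Lemma normalizeZ c v : 0 < c -> normalize (c *: v) = normalize v.
Proof.
move=> c0; rewrite /normalize enormZ ?ltW // scalerA invfM mulrAC mulVf ?mul1r //.
by rewrite gt_eqF.
Qed.

Lemma eq_sphere v w : sphere v -> sphere w -> dot v w = 1 -> v = w.
Proof.
move=> /sphere_dot v1 /sphere_dot w1 e; apply/eqP; rewrite -subr_eq0; apply/eqP.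
apply: dot_eq0; rewrite dotBl dotC dotBl (dotC w (v - w)) dotBl v1 w1 (dotC w) e.
by ring.
Qed.

Lemma dot_normalize v w : v != 0 -> w != 0 ->
  dot v w = enorm v * enorm w * dot (normalize v) (normalize w).
Proof.
move=> /enorm_gt0 v0 /enorm_gt0 w0; rewrite !dotE !mxE.
by field; rewrite !gt_eqF.
Qed.

Lemma triple_normalize v w x : v != 0 -> w != 0 -> x != 0 ->
  triple v w x =
  enorm v * enorm w * enorm x * triple (normalize v) (normalize w) (normalize x).
Proof.
move=> /enorm_gt0 v0 /enorm_gt0 w0 /enorm_gt0 x0; rewrite /triple !mxE.
by field; rewrite !gt_eqF.
Qed.

Lemma sqnorm_ge0 A : 0 <= sqnorm A.
Proof. by rewrite /sqnorm re_mulq_conj !addr_ge0 ?sqr_ge0. Qed.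

Lemma enorm_polar_diag u A : dot u u = 1 -> enorm (polar u A A) = sqnorm A.
Proof.
by move=> u1; rewrite /enorm dot_polar_diag // sqrtr_sqr ger0_norm ?sqnorm_ge0.
Qed.

(** The metric core of the proof: the direction of [polar u A B] determines its
    length once the two vectors [polar u A A] and [polar u B B] are known, provided
    that these have distinct directions. When
    the phases of [A] and [B] vary, [polar u A B] runs over an ellipse centred
    at the origin, and this is the equation of that ellipse; it comes from
    eliminating the real part of [A u B*] between [dot_polar] and
    [triple_polar]. *)
Lemma enorm_polar u A B : dot u u = 1 ->
  polar u A A != 0 -> polar u B B != 0 -> polar u A B != 0 ->
  let a := normalize (polar u A A) in
  let b := normalize (polar u B B) in
  enorm (polar u A B) ^+ 2
    * ((1 - dot a b) ^+ 2 + triple (normalize (polar u A B)) a b ^+ 2)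
  = enorm (polar u A A) * enorm (polar u B B) * (1 - dot a b) ^+ 2.
Proof.
move=> u1 a0 b0 v0 a b.
have := triple_polar A B u1; have := dot_polar A B u1.
rewrite -!(enorm_polar_diag _ u1) -sqr_enorm.
set rho := q_re _.
rewrite (triple_normalize v0 a0 b0) (dot_normalize a0 b0) -/a -/b.
move: (enorm_gt0 a0) (enorm_gt0 b0).
set la := enorm (polar u A A); set lb := enorm (polar u B B).
set lv := enorm _; set v := normalize _ => la0 lb0 n.
rewrite (_ : lv * _ * _ * _ = la * lb * (lv * triple v a b)); last by ring.
rewrite (_ : - rho * _ = la * lb * (- rho * (1 - dot a b))); last by ring.
move=> /(mulfI (mulf_neq0 (lt0r_neq0 la0) (lt0r_neq0 lb0))) e.
by rewrite mulrDr -[X in _ + X]exprMn e -n; ring.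
Qed.

(** The factor [1 - a . b] of [enorm_polar] is nonzero because the end
    directions [a] and [b] differ, so the squared length of [polar u A B] is
    proportional to the product of the lengths of its two neighbours, with a
    factor that depends on directions only. *)
Lemma polar_rigid u A B A' B' (al be : R) : dot u u = 1 -> 0 < al -> 0 < be ->
  polar u A A != 0 -> polar u B B != 0 -> polar u A B != 0 -> polar u A' B' != 0 ->
  normalize (polar u A A) <> normalize (polar u B B) ->
  polar u A' A' = al ^+ 2 *: polar u A A ->
  polar u B' B' = be ^+ 2 *: polar u B B ->
  normalize (polar u A' B') = normalize (polar u A B) ->
  polar u A' B' = (al * be) *: polar u A B.
Proof.
move=> u1 al0 be0 a0 b0 v0 v'0 neq ea eb ev.
have := enorm_polar u1 a0 b0 v0.
have := @enorm_polar u A' B' u1.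
rewrite ea eb !scaler_eq0 !sqrf_eq0 !gt_eqF //= => /(_ a0 b0 v'0).
rewrite !normalizeZ ?exprn_gt0 // ev !enormZ ?sqr_ge0 //.
set K := (_ + _) => e' e.
have M0 : 1 - dot (normalize (polar u A A)) (normalize (polar u B B)) != 0.
  rewrite subr_eq0 eq_sym; apply/eqP => /eq_sphere.
  by move=> /(_ (sphere_normalize a0) (sphere_normalize b0)).
have K0 : K != 0 by rewrite gt_eqF // ltr_pwDl ?sqr_ge0 // exprn_even_gt0.
have l : enorm (polar u A' B') = al * be * enorm (polar u A B).
  apply/eqP; rewrite -(@eqrXn2 _ 2) ?mulr_ge0 ?enorm_ge0 ?(ltW al0) ?(ltW be0) //.
  by apply/eqP/(mulIf K0); rewrite e' exprMn -[RHS]mulrA e; ring.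
by rewrite -[LHS](enorm_normalize v'0) ev l -scalerA enorm_normalize.
Qed.

End Euclid.

(** * Bernstein polynomials *)

Section Bernstein.
Variable R : realType.

(** Evaluation at 0 kills the first coefficient; then ['X] can be cancelled and
    the degree drops by one. Along this induction the binomial coefficients
    would change, which is why they are absorbed into the coefficients. *)
Lemma bernstein_free n (c : nat -> R) :
  \sum_(i < n.+1) c i *: bernstein R n i = 0 -> forall i, (i <= n)%N -> c i = 0.
Proof.
pose b m (d : nat -> R) : {poly R} :=
  \sum_(i < m.+1) d i *: ('X^i * (1 - 'X) ^+ (m - i)).
have bfree m d : b m d = 0 -> forall i, (i <= m)%N -> d i = 0.
  elim: m d => [|m IHm] d; rewrite /b big_ord_recl.
    rewrite big_ord0 addr0 expr0 mul1r subnn alg_polyC => /eqP.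
    by rewrite polyC_eq0 => /eqP d0 [|i].
  move=> e; have : d 0%N = 0.
    move: (congr1 (horner^~ 0) e); rewrite hornerD horner_sum big1 => [|i _].
      by rewrite addr0 expr0 mul1r hornerZ horner_exp
        hornerD hornerN hornerX hornerC subr0 expr1n mulr1 horner0.
    by rewrite lift0 exprS -mulrA hornerZ hornerM hornerX mul0r mulr0.
  move=> d0; have := IHm (d \o succn); rewrite /b.
  suff -> : \sum_(i < m.+1) d i.+1 *: ('X^i * (1 - 'X) ^+ (m - i)) = 0 :> {poly R}.
    by move=> /(_ erefl) IH [|i] // /IH.
  move: e; rewrite d0 scale0r add0r.
  under eq_bigr => i _ do
    rewrite lift0 subSS exprS -mulrA scalerAr.
  by rewrite -mulr_sumr => /eqP; rewrite mulf_eq0 polyX_eq0 => /eqP.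
move=> e i ni; have := bfree n (fun i => c i * 'C(n, i)%:R).
rewrite /b (_ : \sum_(_ < _) _ = \sum_(i < n.+1) c i *: bernstein R n i).
  move=> /(_ e i ni)/eqP; rewrite mulf_eq0 pnatr_eq0 -leqn0 leqNgt bin_gt0 ni orbF.
  by move=> /eqP.
by apply: eq_bigr => j _; rewrite /bernstein scalerA.
Qed.

Lemma bernstein_points_inj n (h h' : 'I_n.+1 -> 'rV[R]_3) :
  \sum_(i < n.+1) bernstein R n i *: map_mx polyC (h i)
  = \sum_(i < n.+1) bernstein R n i *: map_mx polyC (h' i) -> h =1 h'.
Proof.
move=> e i; apply/rowP => k.
have := @bernstein_free n (fun j => h (inord j) 0 k - h' (inord j) 0 k).
rewrite (_ : \sum_(_ < _) _ = 0) => [/(_ erefl i)|].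
  by rewrite inord_val -ltnS ltn_ord => /(_ isT)/eqP; rewrite subr_eq0 => /eqP.
move/rowP: e => /(_ k)/eqP; rewrite !summxE -subr_eq0 -sumrB => /eqP; apply: etrans.
apply: eq_bigr => j _; rewrite !mxE inord_val -mulrBr -polyCB -mul_polyC mulrC.
by [].
Qed.

Lemma horner_bernstein n i (t : R) :
  (bernstein R n i).[t] = 'C(n, i)%:R * (t ^+ i * (1 - t) ^+ (n - i)).
Proof. by rewrite /bernstein !hornerE. Qed.

Lemma denom_gt0 (a b t : R) : 0 < a -> 0 < b -> 0 <= t <= 1 -> 0 < a * (1 - t) + b * t.
Proof. by move=> a0 b0 /andP[t0 t1]; nra. Qed.

Lemma linear_rationalE (a b t : R) : 0 < a -> 0 < b -> 0 <= t <= 1 ->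
  linear_rational (b / a) t = b * t / (a * (1 - t) + b * t).
Proof.
move=> a0 b0 t01; have D0 := denom_gt0 a0 b0 t01; rewrite /linear_rational.
have a_neq0 : a != 0 by rewrite gt_eqF.
have -> : (b / a - 1) * t + 1 = (a * (1 - t) + b * t) / a by field.
by field; rewrite a_neq0 gt_eqF.
Qed.

Lemma linear_rational01 (lam t : R) :
  0 < lam -> 0 <= t <= 1 -> 0 <= linear_rational lam t <= 1.
Proof.
move=> lam0 t01; have D0 := denom_gt0 ltr01 lam0 t01.
rewrite -[lam]divr1 linear_rationalE //.
have /andP[t0 t1] := t01.
by rewrite divr_ge0 ?mulr_ge0 ?(ltW lam0) ?(ltW D0) //= ler_pdivrMr //; nra.
Qed.

(** A geometric weight [a ^+ (n - i) * b ^+ i] on the i-th Bernstein coefficient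
    amounts to replacing the homogeneous parameter [(1 - t : t)] by
    [(a (1 - t) : b t)], whose affine coordinate is a linear rational function
    of [t]. *)
Lemma bernstein_reparam n i (a b t : R) : 0 < a -> 0 < b -> 0 <= t <= 1 ->
  (i <= n)%N ->
  (bernstein R n i).[t] * (a ^+ (n - i) * b ^+ i)
  = (a * (1 - t) + b * t) ^+ n * (bernstein R n i).[linear_rational (b / a) t].
Proof.
move=> a0 b0 t01 ni; have /lt0r_neq0 D0 := denom_gt0 a0 b0 t01.
rewrite linear_rationalE // !horner_bernstein; set D := _ + _ in D0 *.
have -> : 1 - b * t / D = a * (1 - t) / D by rewrite /D; field.
have -> : D ^+ n = D ^+ (n - i) * D ^+ i by rewrite -exprD subnK.
rewrite !expr_div_n !exprMn.
by field; rewrite ?expf_neq0.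
Qed.

Lemma deriv_surj (p : {poly R}) : exists q, q^`() = p.
Proof.
exists (\poly_(i < (size p).+1) (p`_i.-1 / i%:R)); apply/polyP => i.
rewrite coef_deriv coef_poly ltnS /=.
case: ltnP => [_|/leq_sizeP/(_ i (leqnn _)) ->]; last by rewrite mul0rn.
by rewrite -[LHS]mulr_natr divfK ?pnatr_eq0.
Qed.

End Bernstein.

(** * Control points of the hodograph *)

Section ControlPoints.
Variable R : realType.
Implicit Types (u v w x : 'rV[R]_3) (A B : quat R).

Lemma polar_map (S T : comNzRingType) (f : {rmorphism S -> T}) (u : 'rV[S]_3)
    (A B : quat S) :
  polar (map_mx f u) (qmap f A) (qmap f B) = map_mx f (polar u A B).
Proof.
by case: A B => a b c d [a' b' c' d']; apply: row3P; rewrite !mxE /= !mxE; ring.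
Qed.

(** Expanding [A(t) u A(t)*] in the Bernstein basis gives these five points,
    except for the middle one, which would be
    [(2 polar u A1 A1 + polar u A0 A2) / 3]: the class I condition makes the two
    terms agree. *)
Definition preimage_points u A0 A1 A2 (i : 'I_5) : 'rV[R]_3 :=
  nth 0 [:: polar u A0 A0; polar u A0 A1; polar u A1 A1; polar u A1 A2; polar u A2 A2] i.

(** In polarized form the defining condition of class I is homogeneous: it is
    preserved when [A0], [A1], [A2] are scaled by [a ^+ 2], [a * b], [b ^+ 2]. *)
Lemma rrmf5I_conditionP u A0 A1 A2 :
  rrmf5I_condition u A0 A1 A2 <-> polar u A1 A1 = polar u A0 A2.
Proof.
rewrite /rrmf5I_condition -pure_polar -/(polar u A2 A0) (polarC u A2); split=> [|-> //].
exact: (can_inj (@pureK _)).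
Qed.

Lemma polar_quadratic_preimage u A0 A1 A2 : rrmf5I_condition u A0 A1 A2 ->
  let A := quadratic_preimage A0 A1 A2 in
  polar (map_mx polyC u) A A
  = \sum_(i < 5) bernstein R 4 i *: map_mx polyC (preimage_points u A0 A1 A2 i).
Proof.
move=> /rrmf5I_conditionP e /=.
rewrite !big_ord_recr big_ord0 /= /preimage_points /= add0r.
rewrite !polarDl !polarDr !polarZl !polarZr !(polar_map polyC).
rewrite (polarC u A1 A0) (polarC u A2 A0) (polarC u A2 A1) -e.
move: (polar u A0 A0) (polar u A0 A1) (polar u A1 A1) (polar u A1 A2)
  (polar u A2 A2) => P00 P01 P11 P12 P22.
have bernE n i k m : 'C(n, i) = k -> (n - i)%N = m ->
    bernstein R n i = k%:R * ('X^i * (1 - 'X) ^+ m).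
  by rewrite /bernstein => -> ->; rewrite -mul_polyC polyC_natr.
rewrite (bernE 2 0 1 2)%N // (bernE 2 1 2 1)%N // (bernE 2 2 1 0)%N //.
rewrite (bernE 4 0 1 4)%N // (bernE 4 1 4 3)%N // (bernE 4 2 6 2)%N //.
rewrite (bernE 4 3 4 1)%N // (bernE 4 4 1 0)%N //.
by apply: row3P; rewrite !mxE; ring.
Qed.

End ControlPoints.

(** * Rigidity, reparameterization and the tangent indicatrix *)

Section Curve.
Variable R : realType.
Implicit Types (u v w x : 'rV[R]_3) (A B : quat R) (r : 'rV[{poly R}]_3).

Lemma hodograph_surj (H : 'rV[{poly R}]_3) : exists r, hodograph r = H.
Proof.
have /choice [F FP] := @deriv_surj R.
by exists (map_mx F H); apply/rowP => k; rewrite !mxE FP.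
Qed.

Lemma preimage_exists u A0 A1 A2 : rrmf5I_condition u A0 A1 A2 ->
  exists r, rrmf5I_preimage u (quadratic_preimage A0 A1 A2) r.
Proof.
move=> cond; set Q := quadratic_preimage A0 A1 A2.
have [r rP] := hodograph_surj (polar (map_mx polyC u) Q Q).
by exists r; exists A0, A1, A2; split; rewrite // rP pure_polar.
Qed.

Lemma preimage_control_points u A0 A1 A2 r :
  rrmf5I_condition u A0 A1 A2 ->
  pure (hodograph r) = quadratic_preimage A0 A1 A2 * pure (map_mx polyC u)
                       * conjq (quadratic_preimage A0 A1 A2) ->
  hodograph_control_points r (preimage_points u A0 A1 A2).
Proof.
move=> cond e; rewrite /hodograph_control_points -polar_quadratic_preimage //.
by apply: (can_inj (@pureK _)); rewrite e pure_polar.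
Qed.

Lemma control_points_inj r (h h' : 'I_5 -> 'rV[R]_3) :
  hodograph_control_points r h -> hodograph_control_points r h' -> h = h'.
Proof. by move=> e e'; apply/funext/bernstein_points_inj; rewrite -e -e'. Qed.

Definition preimage_directions u A0 A1 A2 (s : 'I_5 -> 'rV[R]_3) :=
  forall i, preimage_points u A0 A1 A2 i != 0
    /\ s i = normalize (preimage_points u A0 A1 A2 i).

Lemma preimage_spherical u (A : quat {poly R}) r s :
  rrmf5I_preimage u A r -> spherical_control_points r s ->
  exists A0 A1 A2, [/\ A = quadratic_preimage A0 A1 A2,
    rrmf5I_condition u A0 A1 A2, preimage_directions u A0 A1 A2 s
    & hodograph_control_points r (preimage_points u A0 A1 A2)].
Proof.
move=> [A0 [A1 [A2 [eA cond e]]]] [h hP hs]; exists A0, A1, A2.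
rewrite eA in e; have hA := preimage_control_points cond e.
by split=> // i; rewrite -(control_points_inj hP hA).
Qed.

(** As [s 2] is equidistant from [s 0] and [s 4], being equal to one of them
    would force [s 0 = s 4]. *)
Lemma admissible_neq u s : admissible u s ->
  [/\ s 0 <> s 4, s 0 <> s 2 & s 2 <> s 4].
Proof.
move=> [[s0 s4 neq] [_ eq2] _ _ _]; split=> // e; apply: neq.
  by apply: eq_sphere => //; rewrite -e (sphere_dot s0) in eq2.
by apply: eq_sphere => //; rewrite e (sphere_dot s4) dotC in eq2.
Qed.

Lemma quartic_root (x : R) : 0 < x -> exists2 a, 0 < a & a ^+ 4 = x.
Proof.
move=> x0; exists (Num.sqrt (Num.sqrt x)); first by rewrite !sqrtr_gt0.
by rewrite (exprM _ 2 2) !sqr_sqrtr ?sqrtr_ge0 ?ltW.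
Qed.

(** Along the chain of control points, [h2] is determined by [h0] and [h4], then
    [h1] by [h0] and [h2], and [h3] by [h2] and [h4]: each is a value of [polar]
    between neighbours with known lengths, and [polar_rigid] applies three
    times. *)
Lemma preimage_points_rigid u A0 A1 A2 B0 B1 B2 s : dot u u = 1 ->
  [/\ s 0 <> s 4, s 0 <> s 2 & s 2 <> s 4] ->
  rrmf5I_condition u A0 A1 A2 -> rrmf5I_condition u B0 B1 B2 ->
  preimage_directions u A0 A1 A2 s -> preimage_directions u B0 B1 B2 s ->
  exists a b : R, [/\ 0 < a, 0 < b &
    forall i, preimage_points u B0 B1 B2 i
              = (a ^+ (4 - i) * b ^+ i) *: preimage_points u A0 A1 A2 i].
Proof.
move=> u1 [n04 n02 n24] /rrmf5I_conditionP cA /rrmf5I_conditionP cB dA dB.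
rewrite /preimage_directions /preimage_points in dA dB.
have [/= A00 s0] := dA 0; have [/= A01 s1] := dA 1; have [/= A11 s2] := dA 2.
have [/= A12 s3] := dA 3; have [/= A22 s4] := dA 4.
have [/= B00 s0'] := dB 0; have [/= B01 s1'] := dB 1; have [/= B11 s2'] := dB 2.
have [/= B12 s3'] := dB 3; have [/= B22 s4'] := dB 4.
rewrite s0 s4 in n04; rewrite s0 s2 in n02; rewrite s2 s4 in n24.
have ratio (P Q : 'rV[R]_3) : P != 0 -> Q != 0 -> normalize Q = normalize P ->
    exists2 c, 0 < c & Q = c ^+ 4 *: P.
  move=> P0 Q0 e; have [c c0 cE] := quartic_root (divr_gt0 (enorm_gt0 Q0) (enorm_gt0 P0)).
  by exists c; rewrite // cE -[LHS](enorm_normalize Q0) e scalerA.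
have [a a0 e0] := ratio _ _ A00 B00 (etrans (esym s0') s0).
have [b b0 e4] := ratio _ _ A22 B22 (etrans (esym s4') s4).
rewrite (exprM _ 2 2) in e0; rewrite (exprM _ 2 2) in e4.
have a20 : 0 < a ^+ 2 by rewrite exprn_gt0.
have b20 : 0 < b ^+ 2 by rewrite exprn_gt0.
have ab0 : 0 < a * b by rewrite mulr_gt0.
(* The class I condition presents [h2] as the polar form of [A0] and [A2]. *)
have e2 : polar u B1 B1 = (a * b) ^+ 2 *: polar u A1 A1.
  rewrite cA cB exprMn; apply: polar_rigid => //; rewrite -?cA -?cB //.
  by rewrite -s2 -s2'.
have e1 : polar u B0 B1 = (a ^+ 2 * (a * b)) *: polar u A0 A1.
  by apply: polar_rigid => //; rewrite -s1 -s1'.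
have e3 : polar u B1 B2 = (a * b * b ^+ 2) *: polar u A1 A2.
  by apply: polar_rigid => //; rewrite -s3 -s3'.
exists a, b; split=> //; apply: ord5P; rewrite /preimage_points /=.
- by rewrite e0; congr (_ *: _); rewrite /=; ring.
- by rewrite e1; congr (_ *: _); rewrite /=; ring.
- by rewrite e2; congr (_ *: _); rewrite /=; ring.
- by rewrite e3; congr (_ *: _); rewrite /=; ring.
- by rewrite e4; congr (_ *: _); rewrite /=; ring.
Qed.

Lemma rescaled_preimage_points u A0 A1 A2 (a b : R) :
  rrmf5I_condition u A0 A1 A2 ->
  let B0 := a ^+ 2 *: A0 in let B1 := (a * b) *: A1 in let B2 := b ^+ 2 *: A2 in
  rrmf5I_condition u B0 B1 B2 /\
  forall i, preimage_points u B0 B1 B2 i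
            = (a ^+ (4 - i) * b ^+ i) *: preimage_points u A0 A1 A2 i.
Proof.
move=> /rrmf5I_conditionP cond; split.
  by apply/rrmf5I_conditionP; rewrite !(polarZl, polarZr) cond !scalerA;
    congr (_ *: _); ring.
by apply: ord5P; rewrite /preimage_points /= !(polarZl, polarZr) scalerA;
  congr (_ *: _); rewrite /=; ring.
Qed.

Lemma qhorner_quadratic A0 A1 A2 (t : R) :
  qhorner (quadratic_preimage A0 A1 A2) t =
  (1 - t) ^+ 2 *: A0 + (2 * t * (1 - t)) *: A1 + t ^+ 2 *: A2.
Proof.
rewrite /quadratic_preimage /qhorner /qmap /=.
case: A0 A1 A2 => a b c d [a1 b1 c1 d1] [a2 b2 c2 d2].
by congr Quat; rewrite /= !hornerD !hornerM !hornerC !horner_bernstein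
    bin0 bin1 binn subn0 subnn;
  rewrite (_ : 2 - 1 = 1)%N //; ring.
Qed.

(** A root [t] would give [2 x t A1 = - (x^2 A0 + t^2 A2)] with [x = 1 - t].
    Comparing hodographs, the class I condition yields
    [x^4 h0 + t^4 h4 = 2 (x t)^2 h2], and this says exactly that
    [x^2 A0 - t^2 A2] has zero hodograph; hence [x^2 A0 = t^2 A2], and the end
    directions coincide. Thus the pre-image is its own root-free part. *)
Lemma quadratic_preimage_neq0 u A0 A1 A2 (t : R) : dot u u = 1 ->
  rrmf5I_condition u A0 A1 A2 ->
  polar u A0 A0 != 0 -> polar u A2 A2 != 0 ->
  normalize (polar u A0 A0) <> normalize (polar u A2 A2) ->
  0 <= t <= 1 ->
  qhorner (quadratic_preimage A0 A1 A2) t != 0.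
Proof.
move=> u1 /rrmf5I_conditionP cond P0 P2 neq /andP[t0 t1].
apply: contra_notN neq; rewrite qhorner_quadratic => /eqP root.
set x := 1 - t in root.
have x0 : 0 <= x by rewrite subr_ge0.
(* [E 1] and [E (-1)] are the sum and the difference of the two end terms. *)
pose E e := x ^+ 2 *: A0 + e *: (t ^+ 2 *: A2).
have polarE e : e ^+ 2 = 1 -> polar u (E e) (E e) =
    x ^+ 4 *: polar u A0 A0 + t ^+ 4 *: polar u A2 A2
    + (2 * e * (x * t) ^+ 2) *: polar u A1 A1.
  move=> e1; rewrite cond /E !polarDl !polarDr !polarZl !polarZr (polarC u A2).
  rewrite (_ : t ^+ 4 = e ^+ 2 * t ^+ 4); last by rewrite e1 mul1r.
  by apply: row3P; rewrite ![in LHS]mxE ![in RHS]mxE; ring.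
have E1 : E 1 = - (2 * t * x) *: A1.
  rewrite /E scale1r scaleNr; apply/eqP; rewrite -addr_eq0 -root.
  by rewrite addrAC.
have : polar u (E (-1)) (E (-1)) = 0.
  rewrite polarE ?sqrrN ?expr1n //.
  have := polarE 1 (expr1n _ _); rewrite E1 polarZl polarZr.
  move: (polar u A0 A0) (polar u A1 A1) (polar u A2 A2) => P00 P11 P22.
  move=> /rowP e; apply/rowP => k; move: (e k); rewrite !mxE.
  by move=> e'; nra.
move=> /(congr1 (@enorm R)); rewrite enorm_polar_diag // -(scale0r 0) enormZ // mul0r.
move=> /eqP; rewrite /sqnorm re_mulq_conj_eq0 /E scaleN1r subr_eq0 => /eqP eA.
have e4 : x ^+ 4 *: polar u A0 A0 = t ^+ 4 *: polar u A2 A2.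
  have := congr1 (fun q => polar u q q) eA; rewrite !(polarZl, polarZr) !scalerA.
  by rewrite -!exprD.
have t_gt0 : 0 < t.
  rewrite lt_neqAle t0 andbT eq_sym; apply: contra_neqN P0 => /eqP t00.
  by move: e4; rewrite /x t00 subr0 expr1n scale1r expr0n scale0r.
have x_gt0 : 0 < x.
  rewrite lt_neqAle x0 andbT eq_sym; apply: contra_neqN P2 => /eqP x00.
  move/esym/eqP: e4; rewrite x00 expr0n scale0r scaler_eq0 expf_eq0 /= gt_eqF //.
  by move/eqP.
by rewrite -(normalizeZ _ (exprn_gt0 4 x_gt0)) e4 normalizeZ // exprn_gt0.
Qed.

Lemma tangent_direction_normalize u (Q : quat {poly R}) (t : R) : dot u u = 1 ->
  tangent_direction u Q t = normalize (polar u (qhorner Q t) (qhorner Q t)).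
Proof. by move=> u1; rewrite /normalize enorm_polar_diag. Qed.

(** As the pre-image has no root, the indicatrix is the direction of the
    hodograph; it therefore depends on the control points only. *)
Lemma tangent_indicatrix_normalize u A0 A1 A2 s (t : R) : dot u u = 1 ->
  rrmf5I_condition u A0 A1 A2 -> preimage_directions u A0 A1 A2 s -> s 0 <> s 4 ->
  0 <= t <= 1 ->
  tangent_indicatrix u (quadratic_preimage A0 A1 A2) t =
  normalize (\sum_(i < 5) (bernstein R 4 i).[t] *: preimage_points u A0 A1 A2 i).
Proof.
move=> u1 cond dA neq t01; set A := quadratic_preimage A0 A1 A2.
rewrite /preimage_directions /preimage_points in dA.
have [/= A00 s0] := dA 0; have [/= A22 s4] := dA 4; rewrite s0 s4 in neq.
have nA (x : R) : 0 <= x <= 1 -> qhorner A x != 0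
  by apply: (quadratic_preimage_neq0 u1).
have A_neq0 : A != 0.
  by apply: contra_neq (nA t t01) => ->; congr Quat; apply: horner0.
rewrite (@tangent_indicatrixE _ u A A t) //; last first.
  by split=> //; exists 1; rewrite scale1r.
rewrite tangent_direction_normalize //; congr normalize.
have := polar_quadratic_preimage cond.
rewrite -/A => /(congr1 (map_mx (horner_eval t))); rewrite -polar_map /=.
rewrite (_ : map_mx _ (map_mx _ _) = u); last first.
  by apply/rowP => k; rewrite !mxE /horner_eval hornerC.
move=> ->; rewrite raddf_sum; apply: eq_bigr => i _.
apply/rowP => k; by rewrite !mxE /= /horner_eval hornerM hornerC.
Qed.

Lemma tangent_indicatrix_reparam u A0 A1 A2 B0 B1 B2 s : dot u u = 1 ->
  [/\ s 0 <> s 4, s 0 <> s 2 & s 2 <> s 4] ->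
  rrmf5I_condition u A0 A1 A2 -> rrmf5I_condition u B0 B1 B2 ->
  preimage_directions u A0 A1 A2 s -> preimage_directions u B0 B1 B2 s ->
  exists2 lambda : R, 0 < lambda & forall t : R, 0 <= t <= 1 ->
    tangent_indicatrix u (quadratic_preimage B0 B1 B2) t
    = tangent_indicatrix u (quadratic_preimage A0 A1 A2) (linear_rational lambda t).
Proof.
move=> u1 neq cA cB dA dB.
have [a [b [a0 b0 e]]] := preimage_points_rigid u1 neq cA cB dA dB.
have [n04 _ _] := neq; exists (b / a) => [|t t01]; first by rewrite divr_gt0.
rewrite (tangent_indicatrix_normalize u1 cA dA) ?linear_rational01 ?divr_gt0 //.
rewrite (tangent_indicatrix_normalize u1 cB dB) //.
rewrite -[RHS](normalizeZ _ (exprn_gt0 4 (denom_gt0 a0 b0 t01))) scaler_sumr.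
congr normalize; apply: eq_bigr => i _.
by rewrite e !scalerA bernstein_reparam // -ltnS.
Qed.

End Curve.

(** * The theorem *)

Theorem proposition3p3 (R : realType) (u : 'rV[R]_3) (u_unit : sphere u)
    (s : 'I_5 -> 'rV[R]_3) (s_adm : admissible u s) :
  [/\ forall l0 l4 : R, 0 < l0 -> 0 < l4 ->
        exists! h : 'I_5 -> 'rV[R]_3,
          [/\ forall i, h i != 0 /\ normalize (h i) = s i,
              enorm (h 0) = l0,
              enorm (h 4) = l4
            & exists2 r : 'rV[{poly R}]_3, rrmf5I_curve u r & hodograph_control_points r h],
      forall (r r' : 'rV[{poly R}]_3) (A A' : quat {poly R}),
        rrmf5I_preimage u A r -> spherical_control_points r s ->
        rrmf5I_preimage u A' r' -> spherical_control_points r' s ->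
        exists2 lambda : R, 0 < lambda &
          forall t : R, 0 <= t <= 1 ->
            tangent_indicatrix u A' t
            = tangent_indicatrix u A (linear_rational lambda t)
    & exists! im : set 'rV[R]_3,
        forall (r : 'rV[{poly R}]_3) (A : quat {poly R}),
          rrmf5I_preimage u A r -> spherical_control_points r s ->
          tangent_image u A = im].
Proof.
have u1 := sphere_dot u_unit.
have neq := admissible_neq s_adm.
have [_ _ _ _ [r0 [P0 P0r0] r0s]] := s_adm.
have reparam (r r' : 'rV[{poly R}]_3) (A A' : quat {poly R}) :
    rrmf5I_preimage u A r -> spherical_control_points r s ->
    rrmf5I_preimage u A' r' -> spherical_control_points r' s ->
    exists2 lambda : R, 0 < lambda & forall t : R, 0 <= t <= 1 ->
      tangent_indicatrix u A' t = tangent_indicatrix u A (linear_rational lambda t).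
  move=> pA sA pA' sA'.
  have [A0 [A1 [A2 [-> cA dA _]]]] := preimage_spherical pA sA.
  have [B0 [B1 [B2 [-> cB dB _]]]] := preimage_spherical pA' sA'.
  exact: tangent_indicatrix_reparam neq cA cB dA dB.
split=> //.
- move=> l0 l4 l0_gt0 l4_gt0.
  have [A0 [A1 [A2 [_ cA dA _]]]] := preimage_spherical P0r0 r0s.
  pose h := preimage_points u A0 A1 A2.
  have h0 i : 0 < enorm (h i) by apply: enorm_gt0; have [] := dA i.
  have [a a0 ea] := quartic_root (divr_gt0 l0_gt0 (h0 0)).
  have [b b0 eb] := quartic_root (divr_gt0 l4_gt0 (h0 4)).
  have [] := rescaled_preimage_points a b cA.
  set B0 := _ *: A0; set B1 := _ *: A1; set B2 := _ *: A2 => cB eB.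
  have [r rP] := preimage_exists cB.
  have abi i : 0 < a ^+ (4 - i) * b ^+ i by rewrite mulr_gt0 ?exprn_gt0.
  have dB : preimage_directions u B0 B1 B2 s.
    move=> i; rewrite eB normalizeZ // -/h; have [hi ->] := dA i; split=> //.
    by rewrite scaler_eq0 gt_eqF ?abi.
  have eB0 : enorm (preimage_points u B0 B1 B2 0) = l0.
    rewrite eB enormZ ?ltW // subn0 expr0 mulr1 ea -/h.
    by rewrite divfK // gt_eqF ?h0.
  have eB4 : enorm (preimage_points u B0 B1 B2 4) = l4.
    rewrite eB enormZ ?ltW // subnn expr0 mul1r eb -/h.
    by rewrite divfK // gt_eqF ?h0.
  exists (preimage_points u B0 B1 B2); split.
    split=> //; last first.
      exists r; first by exists (quadratic_preimage B0 B1 B2).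
      have [C0 [C1 [C2 [_ _ e]]]] := rP.
      exact: preimage_control_points.
    by move=> i; have [? ->] := dB i.
  move=> h' [dh' eh0 eh4 [r' [A' pA'] hr']].
  have sr' : spherical_control_points r' s.
    by exists h' => // i; have [? <-] := dh' i.
  have [C0 [C1 [C2 [_ cC dC hC]]]] := preimage_spherical pA' sr'.
  have eh' := control_points_inj hr' hC; rewrite eh' in eh0 eh4 *.
  have [c [d [c0 d0 eC]]] := preimage_points_rigid u1 neq cB cC dB dC.
  (* A second set [h'] is a rescaling of the first by powers of [c] and [d],
     and the two prescribed lengths force [c = d = 1]. *)
  have one (x l : R) : 0 < x -> 0 < l -> x ^+ 4 * l = l -> x = 1.
    move=> x0 l_gt0 e; apply/eqP; rewrite -(@pexpr_eq1 _ x 4) ?ltW //.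
    by apply/eqP/(mulIf (lt0r_neq0 l_gt0)); rewrite e mul1r.
  have c1 : c = 1.
    apply: (one c l0) => //; rewrite -{2}eh0 eC enormZ ?mulr_ge0 ?exprn_ge0 ?ltW //.
    by rewrite eB0 subn0 expr0 mulr1.
  have d1 : d = 1.
    apply: (one d l4) => //; rewrite -{2}eh4 eC enormZ ?mulr_ge0 ?exprn_ge0 ?ltW //.
    by rewrite eB4 subnn expr0 mul1r.
  by apply/funext => i; rewrite eC c1 d1 !expr1n mulr1 scale1r.
- exists (tangent_image u P0); split=> [r A pA sA|im imP]; last first.
    exact: imP P0r0 r0s.
  (* One inclusion suffices: the roles of the two curves can be exchanged. *)
  have sub (r1 r2 : 'rV[{poly R}]_3) (A1 A2 : quat {poly R}) :
      rrmf5I_preimage u A1 r1 -> spherical_control_points r1 s ->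
      rrmf5I_preimage u A2 r2 -> spherical_control_points r2 s ->
      tangent_image u A2 `<=` tangent_image u A1.
    move=> p1 s1 p2 s2 _ [t /= t01 <-].
    have [lam lam0 e] := reparam _ _ _ _ p1 s1 p2 s2.
    rewrite in_itv /= in t01; exists (linear_rational lam t); last by rewrite e.
    by rewrite /= in_itv /= linear_rational01.
  by apply/seteqP; split; [apply: sub P0r0 r0s pA sA|apply: sub pA sA P0r0 r0s].
Qed.
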